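(* For $1\le i\le r$, $C_{i,r}=G_{i,r-i+2}$.
   Context: Bernoulli numbers $B_n$: $\sum_{n\ge0}B_n x^n/n! = xe^x/(e^x-1)$. For $1\le i\le r$, $C_{i,r}=(-1)^r\sum\prod_{j=1}^rB_{n_j}/n_j!$, the sum over $(n_1,\dots,n_r)\in\mathbb Z_{\ge0}^r$ with $n_1+\dots+n_r=r$, $n_1+\dots+n_j<j$ ($1\le j<i$), and $n_{j+1}+\dots+n_r\le r-j$ ($i\le j<r$). (These are the coefficients of $(\epsilon_i+\dots+\epsilon_r)/(\epsilon_1+\dots+\epsilon_r)$-type terms in the asymptotic expansion of the Euler–Zagier multiple zeta function $\zeta(\epsilon_1,\dots,\epsilon_r)$ at the origin.) The generalized Gregory coefficients $G_{m,n}\in\mathbb Q$ ($m,n\ge0$) are defined by the formal power series identity \[ \sum_{m,n\ge0}G_{m,n}x^my^n=\frac{y\log^2(1+x)-x\log^2(1+y)}{\log(1+x)-\log(1+y)}, \] where $\log^k u=(\log u)^k$. *)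

(* Defs.v *)
From HB Require Import structures.
From mathcomp Require Import all_boot all_order all_algebra.
Unset Printing Implicit Defensive.
Import Order.TTheory GRing.Theory Num.Theory.
Local Open Scope ring_scope.

(* Bernoulli numbers with sum_n B_n x^n/n! = x e^x/(e^x-1) (so B_1 = +1/2).
   Comparing coefficients of x^(n+1) in (sum_k B_k x^k/k!) (e^x - 1) = x e^x
   and multiplying by (n+1)! gives  sum_(k<=n) 'C(n+1,k) B_k = n+1,
   i.e. B_n = (n+1 - sum_(k<n) 'C(n+1,k) B_k)/(n+1).
   bern_seq n = [:: B_0; ...; B_(n-1)]. *)
Fixpoint bern_seq (n : nat) : seq rat :=
  match n with
  | 0 => [::]
  | n'.+1 =>
      let s := bern_seq n' in
      rcons s ((n'.+1%:R - \sum_(k < n') ('C(n'.+1, k))%:R * s`_k) / n'.+1%:R)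
  end.

Definition bernoulli (n : nat) : rat := (bern_seq n.+1)`_n.

(* The condition on (n_1,...,n_r) (stored 0-indexed as f : 'I_r -> 'I_(r+1),
   f j = n_(j+1); each n_j <= r automatically since the total is r). *)
Definition C_index_ok (i r : nat) (f : {ffun 'I_r -> 'I_r.+1}) : bool :=
  [&& (\sum_(k < r) (f k : nat) == r)%N,
      [forall j : 'I_r.+1, ((1 <= j)%N && (j < i)%N) ==>
          (\sum_(k < r | (k < j)%N) (f k : nat) < j)%N]
    & [forall j : 'I_r.+1, ((i <= j)%N && (j < r)%N) ==>
          (\sum_(k < r | (j <= k)%N) (f k : nat) <= r - j)%N]].

Definition C_coef (i r : nat) : rat :=
  (-1) ^+ r * \sum_(f : {ffun 'I_r -> 'I_r.+1} | C_index_ok i r f)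
                 \prod_(j < r) (bernoulli (f j) / ((f j)`!)%:R).

(* Coefficients of log(1+x) = sum_(k>=1) (-1)^(k+1) x^k / k. *)
Definition logc (k : nat) : rat := if k is 0 then 0 else (-1) ^+ k.+1 / k%:R.
Definition log2c (m : nat) : rat := \sum_(a < m.+1) logc a * logc (m - a).
(* Coefficient of x^a y^b in log(1+x) - log(1+y). *)
Definition Ldiff (a b : nat) : rat :=
  if b == 0%N then logc a else if a == 0%N then - logc b else 0.
(* Coefficient of x^m y^n in y log^2(1+x) - x log^2(1+y). *)
Definition numc (m n : nat) : rat :=
  (if n == 1%N then log2c m else 0) - (if m == 1%N then log2c n else 0).

(* G is the coefficient family of the bivariate formal power series
   (y log^2(1+x) - x log^2(1+y)) / (log(1+x) - log(1+y)), i.e.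
   (sum G_(m,n) x^m y^n) * (log(1+x) - log(1+y)) = y log^2(1+x) - x log^2(1+y)
   in Q[[x,y]] (which determines G uniquely, Q[[x,y]] being a domain). *)
Definition is_gregory (G : nat -> nat -> rat) : Prop :=
  forall m n : nat,
    \sum_(a < m.+1) \sum_(b < n.+1) G a b * Ldiff (m - a) (n - b) = numc m n.

(* Main.v *)
(* Absorb the sign (-1)^r by giving a step n the weight beta_n = (-1)^n B_n/n!,
   so that beta(z) = z/(e^z-1) and L = log(1+X) is the solution of L = X beta(L).
   Read (n_1,...,n_r) as the walk d_j = n_1+...+n_j - j, whose steps are >= -1.
   The conditions say that the walk stays negative before time i, jumps at
   step i, and is nonnegative from then on until it ends at d_r = 0. The two
   pieces are first-passage walks, with weights [X^(i-1)] L^k (from 0 to -k) and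
   [X^(r-i+1)] L^(l+1) (from l to 0), and the jump has weight beta_(k+l+1).
   Writing u = log(1+x), v = log(1+y), and using
   sum_(k,l) beta_(k+l+1) u^k v^l = (beta(u)-beta(v))/(u-v), x beta(u) = u and
   y beta(v) = v, the generating function of C_(i,r) x^i y^(r-i+2) is
   v (y u - x v)/(u - v), which differs from the Gregory series only by y u,
   a term of degree one in y. Power series are truncated to polynomials. *)
Require Import Defs.
From HB Require Import structures.
From mathcomp Require Import all_boot all_order all_algebra.
From mathcomp Require Import ring zify.
Import Order.TTheory GRing.Theory Num.Theory.
Local Open Scope ring_scope.

(** * Congruence modulo ['X^N], expressed as divisibility *)

Lemma dvdXnP (N : nat) (p : {poly rat}) :
  reflect (forall i, (i < N)%N -> p`_i = 0) ('X^N %| p).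
Proof.
apply: (iffP idP) => [/dvdpP[q ->] i iN|p0]; first by rewrite coefMXn iN.
apply/dvdpP; exists (drop_poly N p).
rewrite -[LHS](poly_take_drop N) -[RHS]add0r; congr (_ + _).
by apply/polyP => i; rewrite coef_take_poly coef0; case: ifP => // /p0.
Qed.

Lemma dvdXn_comp (N : nat) (p q : {poly rat}) :
  q`_0 = 0 -> 'X^N %| p -> 'X^N %| p \Po q.
Proof.
move=> q0 /(dvdp_comp_poly q); apply: dvdp_trans.
rewrite comp_Xn_poly dvdp_exp2r //.
by rewrite -['X]expr1; apply/dvdXnP => -[].
Qed.

Lemma dvdXn_deriv (N : nat) (p : {poly rat}) :
  p`_0 = 0 -> 'X^N %| p^`() -> 'X^(N.+1) %| p.
Proof.
move=> p0 /dvdXnP dp; apply/dvdXnP => -[//|i] /dp.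
by rewrite coef_deriv => /eqP; rewrite mulrn_eq0 /= => /eqP.
Qed.

(** * Bernoulli numbers, truncated exponential and logarithm *)

Lemma size_bern_seq n : size (bern_seq n) = n.
Proof. by elim: n => //= n IH; rewrite size_rcons IH. Qed.

Lemma nth_bern_seq n k : (k < n)%N -> (bern_seq n)`_k = bernoulli k.
Proof.
elim: n => // n IH; rewrite ltnS leq_eqVlt => /orP[/eqP -> //|kn].
by rewrite /= nth_rcons size_bern_seq kn IH.
Qed.

Lemma bernoulli_sum n :
  \sum_(k < n.+1) 'C(n.+1, k)%:R * bernoulli k = n.+1%:R.
Proof.
rewrite big_ord_recr /= {2}/bernoulli /= nth_rcons size_bern_seq ltnn eqxx.
rewrite binSn [X in _ + X]mulrC divfK ?pnatr_eq0 // addrC -[RHS]addr0 -addrA.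
congr (_ + _); apply/eqP; rewrite addrC subr_eq0; apply/eqP.
by apply: eq_bigr => k _; rewrite nth_bern_seq.
Qed.

Lemma bernoulli_sum_fact n :
  \sum_(k < n.+1) bernoulli k / (k`!)%:R / ((n.+1 - k)`!)%:R
    = (n`!)%:R^-1 :> rat.
Proof.
have f0 m : (m`!)%:R != 0 :> rat by rewrite pnatr_eq0 -lt0n fact_gt0.
apply: (mulfI (f0 n.+1)).
have -> : (n.+1)`!%:R / n`!%:R = n.+1%:R :> rat by rewrite factS natrM mulfK.
rewrite mulr_sumr -bernoulli_sum; apply: eq_bigr => k _.
have kn : (k <= n.+1)%N by apply/ltnW.
rewrite -(bin_fact kn) !natrM.
by field; rewrite !f0.
Qed.

Definition log_trunc N : {poly rat} := \poly_(n < N) logc n.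
Definition exp_trunc N : {poly rat} := \poly_(n < N) (n`!)%:R^-1.
Definition bern_trunc N : {poly rat} := \poly_(n < N) (bernoulli n / (n`!)%:R).

Lemma dvdXn_bern_exp N :
  'X^N %| bern_trunc N * (exp_trunc N - 1) - 'X * exp_trunc N.
Proof.
apply/dvdXnP => i iN; rewrite coefB coefM coefXM big_ord_recr /=.
rewrite coefB !coef_poly coef1 subnn (leq_ltn_trans (leq0n i) iN) fact0 invr1.
rewrite subrr mulr0 addr0; case: i iN => [|i] iN /=; first by rewrite big_ord0 subrr.
rewrite (ltnW iN) -bernoulli_sum_fact; apply/eqP; rewrite subr_eq0; apply/eqP.
apply: eq_bigr => k _; rewrite coefB !coef_poly coef1.
have ki := ltn_ord k.
have [-> ->] : (k < N)%N /\ (i.+1 - k < N)%N by lia.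
by have -> : (i.+1 - k == 0)%N = false; [lia | rewrite subr0].
Qed.

Lemma log_trunc0 N : (log_trunc N)`_0 = 0.
Proof. by rewrite coef_poly; case: ifP. Qed.

Lemma dvdXn_deriv_log M : 'X^M %| (1 + 'X) * (log_trunc M.+1)^`() - 1.
Proof.
have dl i : (i < M)%N -> (log_trunc M.+1)^`()`_i = (-1) ^+ i.
  move=> iM; rewrite coef_deriv coef_poly ltnS iM /logc -[LHS]mulr_natr.
  by rewrite divfK ?pnatr_eq0 // !exprS !mulN1r opprK.
apply/dvdXnP => i iM; rewrite mulrDl mul1r coefB coefD coefXM coef1 dl //.
case: i iM => [|i] iM /=; first by rewrite addr0 subrr.
by rewrite dl ?(ltnW iM) // exprS mulN1r addNr subr0.
Qed.

(** The constant term vanishes, and so does the derivative modulo ['X^M], because E' = E and (1 + X)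
    L' = 1 to that order; integrating gains one power of X. *)
Lemma dvdXn_exp_log M :
  'X^(M.+1) %| (exp_trunc M.+1 \Po - log_trunc M.+1) * (1 + 'X) - 1.
Proof.
set E := exp_trunc _; set L := log_trunc _.
have L0 : (- L)`_0 = 0 by rewrite coefN log_trunc0 oppr0.
apply: dvdXn_deriv.
  rewrite coefB coefM big_ord1 coefD coef1 coefX addr0 mulr1.
  by rewrite -horner_coef0 horner_comp horner_coef0 L0 horner_coef0 coef_poly subrr.
have dE : 'X^M %| (E - E^`()) \Po - L.
  apply: dvdXn_comp => //; apply/dvdXnP => i iM.
  rewrite coefB coef_deriv !coef_poly ltnS (ltnW iM) ltnS iM factS natrM.
  by rewrite -[X in _ - X]mulr_natr invfM mulrAC mulVf ?pnatr_eq0 // mul1r subrr.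
rewrite derivB derivM deriv_comp !derivE.
have -> : (E^`() \Po - L) * - L^`() * (1 + 'X) + (E \Po - L) * (0 + 1) - 0
  = ((E - E^`()) \Po - L) - (E^`() \Po - L) * ((1 + 'X) * L^`() - 1).
  rewrite comp_polyB; ring.
by rewrite dvdp_sub // dvdp_mull // dvdXn_deriv_log.
Qed.

Definition sbern (n : nat) : rat := (-1) ^+ n * (bernoulli n / (n`!)%:R).

Lemma comp_bern_log N : bern_trunc N \Po - log_trunc N =
  \sum_(n < N) (sbern n)%:P * log_trunc N ^+ n.
Proof.
rewrite /bern_trunc poly_def raddf_sum; apply: eq_bigr => n _ /=.
rewrite comp_polyZ comp_Xn_poly exprNn -mul_polyC /sbern [in RHS]polyCM.
by rewrite polyC_exp polyCN mulrCA mulrA.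
Qed.

(** Put z = -L in B(z) (e^z - 1) = z e^z and multiply by 1 + X: since e^(-L) (1 + X) = 1, what
    remains is X B(-L) = L, and B(-z) is the series with coefficients [sbern]. *)
Lemma dvdXn_bern_log M :
  'X^(M.+1) %| 'X * (\sum_(n < M.+1) (sbern n)%:P * log_trunc M.+1 ^+ n)
             - log_trunc M.+1.
Proof.
rewrite -comp_bern_log.
have L0 : (- log_trunc M.+1)`_0 = 0 by rewrite coefN log_trunc0 oppr0.
have h1 := dvdXn_exp_log M.
have := dvdXn_comp _ _ _ L0 (dvdXn_bern_exp M.+1).
rewrite comp_polyB !comp_polyM comp_polyX comp_polyB (comp_polyC 1).
move: (_ \Po _) h1 (_ \Po _) => F h1 S h2; set L := log_trunc _ in h1 h2 *.
have -> : 'X * S - L = (F * (1 + 'X) - 1) * (S + L)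
    - (1 + 'X) * (S * (F - 1) - - L * F) by ring.
by rewrite dvdp_sub // ?(dvdp_mulr _ h1) // dvdp_mull.
Qed.

(** * Coefficients of powers of the logarithm *)

Lemma coef_logX_lt N k m : (m < k)%N -> (log_trunc N ^+ k)`_m = 0.
Proof.
have : 'X^k %| log_trunc N ^+ k.
  rewrite dvdp_exp2r // -['X]expr1; apply/dvdXnP => -[|//] _.
  exact: log_trunc0.
by move/dvdXnP/[apply].
Qed.

(** This is L = X beta(L) multiplied by L^k, read at X^(m+1). *)
Lemma coef_logX_rec M k m : (m < M)%N ->
  (log_trunc M.+1 ^+ k.+1)`_m.+1 =
  \sum_(n < M.+1) sbern n * (log_trunc M.+1 ^+ (k + n))`_m.
Proof.
move=> mM; set L := log_trunc _.
have /dvdXnP/(_ m.+1 mM) : 'X^(M.+1) %|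
    ('X * (\sum_(n < M.+1) (sbern n)%:P * L ^+ n) - L) * L ^+ k.
  by rewrite dvdp_mulr // dvdXn_bern_log.
rewrite mulrBl -exprS coefB -mulrA coefXM /= => /eqP.
rewrite subr_eq0 => /eqP <-; rewrite mulr_suml coef_sum.
by apply: eq_bigr => n _; rewrite -mulrA -exprD coefCM addnC.
Qed.

(** Both sides run over pairs (a, b), the left one only over a + b < N; the rest of the square
    vanishes by hypothesis. *)
Lemma sum_triangle (V : nmodType) N (g : nat -> nat -> V) :
  (forall a b, (N <= a + b)%N -> g a b = 0) ->
  \sum_(n < N) \sum_(b < n.+1) g (n - b)%N b = \sum_(a < N) \sum_(b < N) g a b.
Proof.
move=> g0; transitivity (\sum_(b < N) \sum_(n < N | (b <= n)%N) g (n - b)%N b).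
  rewrite [RHS](exchange_big_dep predT) //=; apply: eq_bigr => n _.
  exact: (big_ord_widen N (fun b => g (n - b)%N b)).
rewrite [RHS]exchange_big /=; apply: eq_bigr => b _.
rewrite -(big_mkord (fun n => (b <= n)%N) (fun n => g (n - b)%N b)).
rewrite -(big_mkord predT (fun a => g a b)).
rewrite -(big_nat_widenl _ 0 _ predT) // [RHS](big_cat_nat (n := N - b)) ?leq_subr //=.
rewrite [X in _ = _ + X]big_nat [X in _ = _ + X]big1 ?addr0 => [|a Na]; last by apply: g0; lia.
rewrite -{1}[b : nat]add0n big_addn.
by apply: eq_bigr => a _; rewrite addnK.
Qed.

(** The recurrence paired with a test function [Phi], regrouped by n = k + a. It serves to add one
    letter a to a walk. *)
Lemma coef_logX_transfer M m (Phi : nat -> rat) : (m < M)%N ->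
  \sum_(n < M.+1) (log_trunc M.+1 ^+ n)`_m *
     \sum_(a < n.+1) sbern a * Phi (n - a)%N =
  \sum_(k < M.+1) (log_trunc M.+1 ^+ k.+1)`_m.+1 * Phi k.
Proof.
move=> mM; set L := log_trunc _.
pose g k a := (L ^+ (k + a))`_m * sbern a * Phi k.
transitivity (\sum_(n < M.+1) \sum_(a < n.+1) g (n - a)%N a).
  apply: eq_bigr => n _; rewrite mulr_sumr; apply: eq_bigr => a _.
  by rewrite /g subnK ?mulrA // -ltnS.
rewrite sum_triangle => [|k a ka]; last first.
  by rewrite /g coef_logX_lt ?mul0r //; lia.
apply: eq_bigr => k _; rewrite coef_logX_rec // mulr_suml.
by apply: eq_bigr => a _; rewrite /g [sbern _ * _]mulrC.
Qed.

(** * Index tuples as words, which can be cut by concatenation *)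

Fixpoint words (c r : nat) : seq (seq nat) :=
  if r is r'.+1 then [seq a :: s | a <- index_iota 0 c, s <- words c r']
  else [:: [::]].

Lemma mem_words c r s :
  (s \in words c r) = (size s == r) && all (fun a => (a < c)%N) s.
Proof.
elim: r s => [|r IH] s; first by rewrite /= inE; case: s.
case: s => [|a s] /=; first by apply/negP => /allpairsP[] [b t] [].
apply/allpairsP/idP => [[[b t]] /= []|].
  rewrite mem_index_iota IH => /andP[_ bc] /andP[/eqP <- ct] [-> ->].
  by rewrite eqxx bc ct.
case/andP=> sr /andP[ac cs]; exists (a, s) => /=.
by rewrite mem_index_iota ac IH -eqSS sr.
Qed.

Lemma words_uniq c r : uniq (words c r).
Proof.
elim: r => //= r IH; apply: allpairs_uniq; rewrite ?iota_uniq //.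
by move=> [a s] [b t] _ _ /= [-> ->].
Qed.

Lemma big_words_cat (V : nmodType) c p q (F : seq nat -> V) :
  \sum_(s <- words c (p + q)) F s =
  \sum_(s <- words c p) \sum_(t <- words c q) F (s ++ t).
Proof.
elim: p F => [|p IH] F /=; first by rewrite big_seq1.
rewrite !big_allpairs_dep; apply: eq_bigr => a _; exact: IH.
Qed.

Lemma big_words_rcons (V : nmodType) c p (F : seq nat -> V) :
  \sum_(s <- words c p.+1) F s =
  \sum_(s <- words c p) \sum_(0 <= a < c) F (rcons s a).
Proof.
rewrite -addn1 big_words_cat; apply: eq_bigr => s _.
rewrite big_allpairs_dep; apply: eq_bigr => a _.
by rewrite big_seq1 cats1.
Qed.

Lemma big_ffun_words (V : nmodType) c r (F : seq nat -> V) :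
  \sum_(f : {ffun 'I_r -> 'I_c}) F [seq (f k : nat) | k : 'I_r] =
  \sum_(s <- words c r) F s.
Proof.
rewrite -(big_map (fun f : {ffun 'I_r -> 'I_c} => [seq (f k : nat) | k : 'I_r])
   predT F).
apply: perm_big; apply: uniq_perm.
- rewrite map_inj_uniq ?index_enum_uniq // => f g /eq_in_map fg.
  by apply/ffunP => k; apply: val_inj; apply: fg; rewrite mem_enum.
- exact: words_uniq.
move=> s; rewrite mem_words; apply/mapP/andP => [[f _ ->]|[/eqP sr /allP cs]].
  by rewrite size_map size_enum_ord; split=> //; apply/allP => a /mapP[k _ ->].
have lt k : (k < r)%N -> (nth 0%N s k < c)%N.
  by move=> kr; apply: cs; rewrite mem_nth ?sr.
exists [ffun k : 'I_r => Ordinal (lt k (ltn_ord k))]; first by rewrite mem_index_enum.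
apply: (@eq_from_nth _ 0%N); first by rewrite size_map size_enum_ord.
move=> k; rewrite sr => kr.
rewrite (nth_map (Ordinal kr)) ?size_enum_ord // ffunE /=.
by rewrite nth_enum_ord.
Qed.

(** * Walks before and after the jump *)

Definition prefix_ok (s : seq nat) :=
  all (fun j => (sumn (take j s) < j)%N) (iota 1 (size s)).
(** Heights are measured back from the endpoint 0: at time j the height is [size s - j] minus the
    sum of the remaining letters. The case j = 0 is the position just after the jump. *)
Definition suffix_ok (s : seq nat) :=
  all (fun j => (sumn (drop j s) <= size s - j)%N) (iota 0 (size s)).
Definition weight (s : seq nat) : rat := \prod_(a <- s) sbern a.

Lemma prefix_ok_rcons s a :
  prefix_ok (rcons s a) = prefix_ok s && (sumn s + a <= size s)%N.
Proof.
rewrite /prefix_ok size_rcons -[(size s).+1]addn1 iotaD all_cat /= andbT add1n.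
rewrite take_oversize ?size_rcons // sumn_rcons ltnS; congr (_ && _).
apply: eq_in_all => j; rewrite mem_iota => /andP[_ js].
by rewrite -cats1 takel_cat //; lia.
Qed.

Lemma suffix_ok_cons a s :
  suffix_ok (a :: s) = (a + sumn s <= (size s).+1)%N && suffix_ok s.
Proof.
rewrite /suffix_ok /= (iotaDl 1 0) all_map.
by congr (_ && _); apply: eq_all.
Qed.

Lemma prefix_ok_sumn s : prefix_ok s -> (sumn s <= size s)%N.
Proof.
case/lastP: s => // s a; rewrite prefix_ok_rcons sumn_rcons size_rcons.
by case/andP=> _ /leqW.
Qed.

Lemma suffix_ok_sumn s : suffix_ok s -> (sumn s <= size s)%N.
Proof. by case: s => // a s; rewrite suffix_ok_cons => /andP[]. Qed.

Lemma big_nat_ord_lt (c n : nat) (F : nat -> rat) (P : pred nat) :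
  (n <= c)%N -> (forall a, P a = (a < n)%N) ->
  \sum_(0 <= a < c | P a) F a = \sum_(a < n) F a.
Proof.
move=> nc Pn; rewrite -(big_mkord predT F) (big_nat_widen _ _ _ _ _ nc) /=.
exact: eq_bigl.
Qed.

(* Testing against an arbitrary Phi says that the words ending at height -k have
   total weight [X^p] L^k; in this dual form the induction on p is the transfer
   identity above, applied at the last letter. *)
Lemma sum_prefix M c p (Phi : nat -> rat) : (p <= M)%N -> (p <= c)%N ->
  \sum_(s <- words c p | prefix_ok s) weight s * Phi (p - sumn s)%N =
  \sum_(k < M.+1) (log_trunc M.+1 ^+ k)`_p * Phi k.
Proof.
elim: p Phi => [|p IH] Phi pM pc.
  rewrite big_cons big_nil /weight big_nil mul1r addr0 big_ord_recl expr0.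
  rewrite coef1 mul1r big1 ?addr0 // => k _; by rewrite coef_logX_lt ?mul0r.
rewrite big_mkcond big_words_rcons big_ord_recl expr0 coef1 mul0r add0r.
(* A letter a leads from depth n to depth n + 1 - a, which must stay positive: hence a <= n and the
   shift in [Phi']. *)
pose Phi' k := Phi k.+1; pose Psi n := \sum_(a < n.+1) sbern a * Phi' (n - a)%N.
transitivity (\sum_(k < M.+1) (log_trunc M.+1 ^+ k.+1)`_p.+1 * Phi' k); last first.
  by rewrite big_ord_recr /= coef_logX_lt // mul0r addr0.
rewrite -coef_logX_transfer // -(IH Psi) ?(ltnW pM) ?(ltnW pc) //.
rewrite [RHS]big_mkcond big_seq [RHS]big_seq; apply: eq_bigr => s.
rewrite mem_words => /andP[/eqP sp _].
under eq_bigr do rewrite prefix_ok_rcons.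
case: ifPn => os /=; last by rewrite big1.
have ss := prefix_ok_sumn s os; rewrite sp in ss *.
rewrite -big_mkcond (big_nat_ord_lt _ (p - sumn s).+1) => [||a] /=; try lia.
rewrite mulr_sumr; apply: eq_bigr => a _.
rewrite /weight -cats1 big_cat big_seq1 /= sumn_cat /= addn0 mulrA.
by congr (_ * Phi _); have := ltn_ord a; lia.
Qed.

(** The same dual induction, now on the first letter: a walk starting at height l, preceded by the
    letter a, starts at l + 1 - a, which is nonnegative exactly when a < l + 2. *)
Lemma sum_suffix M c q (Phi : nat -> rat) : (q < M)%N -> (q < c)%N ->
  \sum_(s <- words c q | suffix_ok s) weight s * Phi (q - sumn s)%N =
  \sum_(k < M.+1) (log_trunc M.+1 ^+ k.+1)`_q.+1 * Phi k.
Proof.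
elim: q Phi => [|q IH] Phi qM qc.
  rewrite big_cons big_nil /weight big_nil mul1r addr0 big_ord_recl expr1.
  rewrite big1 => [|k _]; last by rewrite coef_logX_lt ?mul0r.
  by rewrite addr0 coef_poly ltnS qM /logc /= sqrrN expr1n divr1 mul1r.
rewrite -coef_logX_transfer // big_ord_recl expr0 coef1 mul0r add0r.
pose Psi l := \sum_(a < l.+2) sbern a * Phi (l.+1 - a)%N.
transitivity (\sum_(l < M.+1) (log_trunc M.+1 ^+ l.+1)`_q.+1 * Psi l); last first.
  by rewrite big_ord_recr /= coef_logX_lt ?mul0r ?addr0 //; lia.
rewrite -IH ?(ltnW qM) ?(ltnW qc) // big_mkcond /= big_allpairs_dep exchange_big /=.
rewrite [RHS]big_mkcond big_seq [RHS]big_seq; apply: eq_bigr => s.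
rewrite mem_words => /andP[/eqP sq _].
under eq_bigr do rewrite suffix_ok_cons andbC.
case: ifPn => os /=; last by rewrite big1.
have ss := suffix_ok_sumn s os; rewrite sq in ss *.
rewrite -big_mkcond (big_nat_ord_lt _ (q - sumn s).+2) => [||a] /=; try lia.
rewrite mulr_sumr; apply: eq_bigr => a _.
rewrite /weight big_cons mulrCA mulrA.
by congr (_ * Phi _); have := ltn_ord a; lia.
Qed.

(** * [C_coef] as a sum over words cut at the jump *)

Lemma sumn_take_codom r (f : 'I_r -> nat) j :
  sumn (take j [seq f k | k : 'I_r]) = (\sum_(k < r | (k < j)%N) f k)%N.
Proof.
elim: r f j => [|r IH] f j; first by rewrite /image_mem enum_ord0 big_ord0.
case: j => [|j]; first by rewrite take0 big_pred0.
rewrite /image_mem enum_ordSl /= -map_comp IH [RHS]big_mkcond big_ord_recl /=.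
by rewrite -big_mkcond.
Qed.

Lemma sumn_drop_codom r (f : 'I_r -> nat) j :
  sumn (drop j [seq f k | k : 'I_r]) = (\sum_(k < r | (j <= k)%N) f k)%N.
Proof.
apply: (@addnI (sumn (take j [seq f k | k : 'I_r]))).
rewrite -sumn_cat cat_take_drop sumn_take_codom.
rewrite sumnE big_map big_enum [LHS](bigID (fun k : 'I_r => (k < j)%N)) /=.
by congr addn; apply: eq_bigl => k; rewrite -leqNgt.
Qed.

Definition C_word_ok (i : nat) (s : seq nat) :=
  [&& sumn s == size s,
      all (fun j => sumn (take j s) < j)%N (iota 1 i.-1)
    & all (fun j => sumn (drop j s) <= size s - j)%N (iota i (size s - i))].

Lemma C_index_okE i r (f : {ffun 'I_r -> 'I_r.+1}) : (1 <= i <= r)%N ->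
  C_index_ok i r f = C_word_ok i [seq (f k : nat) | k : 'I_r].
Proof.
move=> ir; rewrite /C_index_ok /C_word_ok size_map size_enum_ord.
congr [&& _, _ & _].
- by rewrite sumnE big_map big_enum.
- apply/forallP/allP => [h j|h j].
    rewrite mem_iota => ji; have jr : (j < r.+1)%N by lia.
    have := h (Ordinal jr); rewrite sumn_take_codom /= => /implyP; apply; lia.
  by apply/implyP => ji; rewrite -sumn_take_codom; apply: h; rewrite mem_iota; lia.
apply/forallP/allP => [h j|h j].
  rewrite mem_iota => ji; have jr : (j < r.+1)%N by lia.
  have := h (Ordinal jr); rewrite sumn_drop_codom /= => /implyP; apply; lia.
by apply/implyP => ji; rewrite -sumn_drop_codom; apply: h; rewrite mem_iota; lia.
Qed.

(** The letters add up to [r], so the global sign is the product of the signs inside [sbern]. *)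
Lemma C_coef_words i r : (1 <= i <= r)%N ->
  C_coef i r = \sum_(s <- words r.+1 r | C_word_ok i s) weight s.
Proof.
move=> ir; rewrite [RHS]big_mkcond -big_ffun_words -[RHS]big_mkcond /C_coef mulr_sumr.
apply: eq_big => [f|f fok]; first exact: C_index_okE.
rewrite /weight big_map big_enum /sbern [RHS]big_split /= prodrXr.
by case/and3P: fok => /eqP ->.
Qed.

(** The condition on the total forces the jump letter a. The truncated subtractions are genuine,
    since both pieces have sum at most their length. *)
Lemma C_word_ok_cat s a t :
  C_word_ok (size s).+1 (s ++ a :: t) =
  [&& prefix_ok s, suffix_ok t
    & a == (size s - sumn s + (size t - sumn t)).+1].
Proof.
rewrite /C_word_ok size_cat /= addnS subSS addKn.
have -> : all (fun j => sumn (take j (s ++ a :: t)) < j)%N (iota 1 (size s))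
          = prefix_ok s.
  by apply: eq_in_all => j; rewrite mem_iota => js; rewrite takel_cat //; lia.
have -> : all (fun j => sumn (drop j (s ++ a :: t)) <= (size s + size t).+1 - j)%N
              (iota (size s).+1 (size t)) = suffix_ok t.
  rewrite -[in iota _ _](addn0 (size s).+1) iotaDl all_map; apply: eq_all => j /=.
  by rewrite -cat_rcons drop_cat size_rcons addKn ltnNge leq_addr /= addSn subSS subnDl.
rewrite andbC -andbA; have [/prefix_ok_sumn ps|] //= := boolP (prefix_ok s).
have [/suffix_ok_sumn st|] //= := boolP (suffix_ok t).
rewrite sumn_cat /=; lia.
Qed.

Lemma C_coef_log M p q : (p + q < M)%N ->
  C_coef p.+1 (p + q).+1 =
  \sum_(k < M.+1) \sum_(l < M.+1) sbern (k + l).+1 *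
     ((log_trunc M.+1 ^+ k)`_p * (log_trunc M.+1 ^+ l.+1)`_q.+1).
Proof.
move=> pqM; rewrite C_coef_words ?leq_addr // -addnS big_mkcond big_words_cat.
set c := (p + q.+1).+1.
(* The contribution of the jump and of everything after it, when the prefix ends at height -k. *)
pose Phi k := \sum_(l < M.+1) (log_trunc M.+1 ^+ l.+1)`_q.+1 * sbern (k + l).+1.
transitivity (\sum_(s <- words c p | prefix_ok s) weight s * Phi (p - sumn s)%N).
  rewrite [RHS]big_mkcond big_seq [RHS]big_seq; apply: eq_bigr => s.
  rewrite mem_words => /andP[/eqP sp _].
  rewrite big_allpairs_dep exchange_big /= /Phi.
  case: ifPn => sok; last first.
    rewrite big1 // => t _; rewrite big1 // => a _.
    by rewrite -sp C_word_ok_cat (negbTE sok).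
  rewrite -(sum_suffix M c q (fun l => sbern (p - sumn s + l).+1)) ?mulr_sumr; try lia.
  rewrite [RHS]big_mkcond big_seq [RHS]big_seq; apply: eq_bigr => t.
  rewrite mem_words => /andP[/eqP tq _].
  under eq_bigr do rewrite -sp C_word_ok_cat sok sp tq /=.
  case: ifPn => tok; last by rewrite big1.
  rewrite -big_mkcond big_nat1_eq; case: ifPn => [_|]; last by rewrite /c; lia.
  by rewrite /weight big_cat big_cons /=; congr (_ * _); rewrite mulrC.
rewrite (sum_prefix M); try lia.
apply: eq_bigr => k _; rewrite mulr_sumr; apply: eq_bigr => l _.
by rewrite mulrA mulrC.
Qed.

(** * Uniqueness of the quotient and the truncated Gregory series *)

Lemma Ldiff_conv_inj N (D : nat -> nat -> rat) :
  (forall m n, (m < N)%N -> (n < N)%N ->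
     \sum_(a < m.+1) \sum_(b < n.+1) D a b * Ldiff (m - a) (n - b) = 0) ->
  forall m n, (m + n < N.-1)%N -> D m n = 0.
Proof.
move=> D0 m n mnN.
(* Induct on the total degree, then on n. Since log(1+x) - log(1+y) starts with x - y, the equation
   at (m+1, n) contains [D m n] with coefficient 1; each other term has lower total degree, or the
   same degree and smaller n, or a zero factor. *)
have [t] := ubnP (m + n); elim: t m n mnN => // t IHt m n.
elim/ltn_ind: n m => n IHn m mnN mnt.
have := D0 m.+1 n; rewrite big_ord_recr big_ord_recr /= [X in _ + _ + X]big1; last first.
  move=> [b bn] _ /=; rewrite subnn /Ldiff /=; case: eqP => [|/eqP nb0]; first by rewrite mulr0.
  by rewrite IHn ?mul0r //; lia.
rewrite addr0 big1 ?add0r => [|[a am] _] /=; last first.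
  rewrite big1 // => -[b bn] _ /=.
  rewrite IHt ?mul0r //; lia.
rewrite big_ord_recr /= big1 ?add0r => [|[b bn] _] /=; last first.
  by rewrite /Ldiff; case: eqP => [|_]; [lia|case: eqP => [|_]; [lia|rewrite mulr0]].
rewrite subnn subSnn /Ldiff /= sqrrN expr1n divr1; apply; lia.
Qed.

(* The outer variable 'X of {poly {poly rat}} is y, the inner one is x: the
   coefficient of x^a y^b in P is P`_b`_a. The summand y u is the discrepancy with
   the generating function of the C_(i,r). *)
Definition gregory_trunc (M : nat) : {poly {poly rat}} :=
  let L := log_trunc M.+1 in
  let u := L%:P in let v := map_poly polyC L in
  'X * u + 'X * 'X%:P * v * \sum_(n < M.+1) (sbern n)%:P%:P *
                               \sum_(k < n) u ^+ (n.-1 - k) * v ^+ k.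

Lemma log2c_trunc M m : (m < M.+1)%N -> (log_trunc M.+1 ^+ 2)`_m = log2c m.
Proof.
move=> mM; rewrite expr2 coefM; apply: eq_bigr => -[k km] _ /=.
by rewrite !coef_poly; have [-> ->] : (k < M.+1)%N /\ (m - k < M.+1)%N by lia.
Qed.

(** With x beta(u) = u and y beta(v) = v the product is y u (u - v) + v (y u - x v) = y u^2 - x v^2.
    Truncation adds only multiples of x^(M+1) or y^(M+1), invisible at (m, n). *)
Lemma gregory_trunc_mul M m n : (m < M.+1)%N -> (n < M.+1)%N ->
  (gregory_trunc M * ((log_trunc M.+1)%:P - map_poly polyC (log_trunc M.+1)))`_n`_m
  = numc m n.
Proof.
move=> mM nM; rewrite /gregory_trunc /=; set L := log_trunc M.+1.
set u := L%:P; set v := map_poly polyC L.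
pose x : {poly {poly rat}} := 'X%:P; pose y : {poly {poly rat}} := 'X.
pose S := \sum_(n < M.+1) (sbern n)%:P * L ^+ n.
have [Q SQ] : exists Q, 'X * S = L + Q * 'X^(M.+1).
  by have /dvdpP[Q e] := dvdXn_bern_log M; exists Q; rewrite -e addrC subrK.
have Su : \sum_(n < M.+1) (sbern n)%:P%:P * u ^+ n = S%:P.
  by rewrite /S [RHS]rmorph_sum; apply: eq_bigr => k _; rewrite [RHS]polyCM polyC_exp.
have Sv : \sum_(n < M.+1) (sbern n)%:P%:P * v ^+ n = map_poly polyC S.
  rewrite /S [RHS]rmorph_sum; apply: eq_bigr => k _ /=.
  by rewrite [RHS]rmorphM /= map_polyC rmorphXn.
set T := (X in 'X * 'X%:P * v * X); rewrite -/x -/y.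
(* The inner geometric sums of [T] are the quotients (u^n - v^n) / (u - v). *)
have TE : T * (u - v) = S%:P - map_poly polyC S.
  rewrite -Su -Sv -sumrB mulr_suml; apply: eq_bigr => k _.
  by rewrite -mulrBr subrXX -mulrA [_ * (u - v)]mulrC.
have xS : x * S%:P = u + (Q * 'X^(M.+1))%:P by rewrite -polyCM SQ polyCD.
have yS : y * map_poly polyC S = v + map_poly polyC Q * y ^+ M.+1.
  by rewrite -[y in LHS](map_polyX polyC) -rmorphM SQ rmorphD rmorphM /= map_polyXn.
have -> : (y * u + y * x * v * T) * (u - v) =
    y * (L ^+ 2)%:P - x * map_poly polyC (L ^+ 2)
    + y * v * (Q * 'X^(M.+1))%:P - x * v * map_poly polyC Q * y ^+ M.+1.
  transitivity (y * u * (u - v) + y * x * v * (T * (u - v))); first by ring.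
  rewrite TE.
  transitivity (y * u * (u - v) + y * v * (x * S%:P) - x * v * (y * map_poly polyC S)).
    by ring.
  by rewrite xS yS polyC_exp rmorphXn /=; ring.
have cN (p : {poly {poly rat}}) i : (- p)`_i = - p`_i := coefN p i.
rewrite /x /y !(coefD, cN, coefN) coefMXn nM coef0 subr0.
have -> : ('X * v * (Q * 'X^(M.+1))%:P)`_n`_m = 0.
  by rewrite coefMC mulrA coefMXn mM.
rewrite addr0 coefXM coefC coefCM coef_map coefXM /= /numc; congr (_ - _).
  case: n {nM} => [|[|n]] /=; rewrite ?coef0 //; exact: log2c_trunc.
case: m {mM} => [|[|m]] //=; rewrite coefC //=; exact: log2c_trunc.
Qed.

Lemma coef_gregory_trunc_mul M (m n : nat) : (m < M.+1)%N -> (n < M.+1)%N ->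
  (gregory_trunc M * ((log_trunc M.+1)%:P - map_poly polyC (log_trunc M.+1)))`_n`_m
  = \sum_(a < m.+1) \sum_(b < n.+1) (gregory_trunc M)`_b`_a * Ldiff (m - a) (n - b).
Proof.
move=> mM nM; rewrite coefM coef_sum exchange_big /=; apply: eq_bigr => -[b bn] _ /=.
rewrite coefM; apply: eq_bigr => -[a am] _ /=; congr (_ * _).
have Lc k j : (k < M.+1)%N -> (log_trunc M.+1)`_(k - j) = logc (k - j).
  by move=> kM; rewrite coef_poly (leq_ltn_trans (leq_subr j k) kM).
rewrite coefB coefC coef_map /= (Lc n) // coefB coefC.
rewrite (fun_if (fun p : {poly rat} => p`_(m - a))) coef0 (Lc m) // /Ldiff.
case: (n - b)%N => [|k] /=; case: (m - a)%N => [|l] //=.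
all: by rewrite ?subrr ?subr0 ?sub0r.
Qed.

(** The factor x y v shifts u^k v^l to u^k v^(l+1) read at x^p y^(q+1); the summand y u has y-degree
    one and is not seen at y^(q+2). Terms with k + l >= M vanish, as then k > p or l > q. *)
Lemma coef_gregory_trunc M p q : (p + q < M)%N ->
  (gregory_trunc M)`_q.+2`_p.+1 = C_coef p.+1 (p + q).+1.
Proof.
move=> pqM; rewrite (C_coef_log M) // /gregory_trunc /=.
set L := log_trunc _.
pose g k l := sbern (k + l).+1 * ((L ^+ k)`_p * (L ^+ l.+1)`_q.+1).
rewrite !coefD coefXM coefC /= coef0 add0r -!mulrA coefXM /= coefCM coefXM /=.
rewrite mulr_sumr !coef_sum big_ord_recl big_ord0 !mulr0 !coef0 add0r.
transitivity (\sum_(n < M) \sum_(l < n.+1) g (n - l)%N l).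
  apply: eq_bigr => n _; rewrite mulrCA !coefCM mulr_sumr !coef_sum mulr_sumr.
  apply: eq_bigr => k _; rewrite mulrCA -exprS -polyC_exp -rmorphXn /=.
  by rewrite coefCM coef_map coefMC /g subnK // -ltnS.
have g0 k l : (M <= k + l)%N -> g k l = 0.
  move=> kl; rewrite /g; have [pk|kp] := ltnP p k.
    by rewrite (coef_logX_lt _ k) // mul0r mulr0.
  by rewrite (coef_logX_lt _ l.+1) ?mulr0 //; lia.
rewrite sum_triangle // [RHS]big_ord_recr [X in _ = _ + X]big1 ?addr0 => [|l _]; last first.
  by rewrite [LHS](g0 M) // leq_addr.
apply: eq_bigr => k _; rewrite [RHS]big_ord_recr /= [X in _ = _ + X](g0 k M) ?leq_addl //.
by rewrite addr0.
Qed.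

Theorem theorem4p2 (G : nat -> nat -> rat) (HG : is_gregory G)
  (i r : nat) (hi : (1 <= i)%N) (hir : (i <= r)%N) :
  C_coef i r = G i (r - i + 2)%N.
Proof.
case: i hi hir => // p _ pr; have [q ->] : exists q, r = (p + q).+1.
  by exists (r - p.+1)%N; lia.
have -> : ((p + q).+1 - p.+1 + 2 = q.+2)%N by lia.
(* The coefficient sought has total degree p + q + 3, which uniqueness requires to be below [M]. *)
pose M := (p + q + 4)%N.
rewrite -(coef_gregory_trunc M); last by lia.
apply/eqP; rewrite -subr_eq0; apply/eqP.
(* Both families have the same product with log(1+x) - log(1+y) in this range, so their difference
   is annihilated. *)
apply: (Ldiff_conv_inj M.+1 (fun a b => (gregory_trunc M)`_b`_a - G a b)); last by lia.
move=> m n mM nM; under eq_bigr => a _ do under eq_bigr => b _ do rewrite mulrBl.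
under eq_bigr => a _ do rewrite sumrB.
by rewrite sumrB HG -coef_gregory_trunc_mul // gregory_trunc_mul // subrr.
Qed.
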